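(* Let $k\ge 2$ and let $T$ be a tree of order $n$ with $\gamma_k(T)=2$. Then \[ \Pi_1(T)\ge 4^{2k-1}(n-2k)^2 \quad\text{and}\quad \Pi_2(T)\le 4^{2k-1}(n-2k)^{n-2k}. \] Either equality holds if and only if $T\cong T^a_{n,k,2}$ for some $a\in\{1,\dots,k\}$.
   Context: For a graph $G$ with vertex degrees $d_G(u)$: $\Pi_1(G)=\prod_{u\in V(G)}d_G(u)^2$ and $\Pi_2(G)=\prod_{uv\in E(G)}d_G(u)d_G(v)=\prod_{u\in V(G)}d_G(u)^{d_G(u)}$. A set $D\subseteq V(G)$ is a distance $k$-dominating set if every vertex not in $D$ is at distance at most $k$ from some vertex of $D$; $\gamma_k(G)$ is the minimum size of such a set. For $n\ge 2k+2$ and $a\in\{1,\dots,k\}$, $T^a_{n,k,2}$ is the tree obtained from the path $v_0v_1\cdots v_{2k+1}$ on $2k+2$ vertices by attaching $n-2(k+1)$ new pendent vertices to $v_a$. *)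

(* Defs.v *)
From mathcomp Require Import all_boot.
Set Implicit Arguments. Unset Strict Implicit. Unset Printing Implicit Defensive.

Section Graphs.
Variable n : nat.
Implicit Types (e : rel 'I_n) (u v : 'I_n).

Definition simple_graph e := symmetric e /\ irreflexive e.

Definition edges e : {set 'I_n * 'I_n} := [set p : 'I_n * 'I_n | (p.1 < p.2) && e p.1 p.2].

Definition is_tree e :=
  simple_graph e /\ (forall u v, connect e u v) /\ #|edges e| = n.-1.

Definition deg e u : nat := #|[set w | e u w]|.

Definition Pi1 e : nat := \prod_(u : 'I_n) deg e u ^ 2.
Definition Pi2 e : nat := \prod_(p in edges e) (deg e p.1 * deg e p.2).

Definition dist_le e k u v :=
  exists p : seq 'I_n, [/\ path e u p, last u p = v & size p <= k].

Definition dist_k_dominating e k (D : {set 'I_n}) :=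
  forall v, v \notin D -> exists2 u, u \in D & dist_le e k u v.

Definition gamma_k_eq e k m :=
  (exists D, dist_k_dominating e k D /\ #|D| = m) /\
  (forall D, dist_k_dominating e k D -> m <= #|D|).

Definition isomorphic e1 e2 :=
  exists f : 'I_n -> 'I_n, bijective f /\ forall u v, e1 u v = e2 (f u) (f v).

(* T^a_{n,k,2}: path v_0 ... v_{2k+1} (v_i = i) plus pendent vertices
   2k+2, ..., n-1 all attached to v_a. *)
Definition Tak (k a : nat) : rel 'I_n := fun u v =>
  [|| ((u.+1 == v :> nat) && (v <= k.*2.+1)),
      ((v.+1 == u :> nat) && (u <= k.*2.+1)),
      ((k.*2.+2 <= u) && (v == a :> nat)) |
      ((k.*2.+2 <= v) && (u == a :> nat))].

End Graphs.

(* Main.v *)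
(** Since [gamma_k = 2], no vertex is within distance [k] of all others; in a
    tree this forces a path with [2k + 2] vertices, hence a set [S] of [2k]
    inner vertices of degree at least 2. The degree sum is [2 (n - 1)], and both
    [d |-> 1 / d] and [d |-> d ^ d] are strictly log-convex: for such an [h],
    shifting all excess degree onto one vertex of maximal degree in [S] strictly
    increases [\prod_u h (deg u)], unless all other degrees are already 2 on
    [S] and 1 elsewhere. In that extremal case every vertex off the path is a
    leaf hanging on the one exceptional inner vertex. *)

Require Import Defs.
From mathcomp Require Import all_boot all_order all_algebra zify ring.
Set Implicit Arguments. Unset Strict Implicit. Unset Printing Implicit Defensive.

(** * Smoothing for strictly log-convex weights *)

Section Smoothing.
Import Order.TTheory GRing.Theory Num.Theory.
Local Open Scope ring_scope.
Variables (R : numDomainType) (h : nat -> R).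
Hypothesis h_gt0 : forall x, (0 < x)%N -> 0 < h x.
Hypothesis h1 : h 1 = 1.
Hypothesis h_logconvex : forall x, (0 < x)%N -> h x.+1 * h x.+1 < h x * h x.+2.

(** Log-convexity says that the ratios [h x.+1 / h x] increase; induction on [c] chains these
    comparisons in cross-multiplied form. *)
Lemma h_ratio_lt b c : (0 < b < c)%N -> h b.+1 * h c < h b * h c.+1.
Proof.
move=> /andP[b_gt0]; elim: c => // c IHc.
rewrite ltnS leq_eqVlt => /predU1P[<-|bc]; first exact: h_logconvex.
have hc : 0 < h c by apply: h_gt0; lia.
rewrite -(ltr_pM2r hc).
have /lt_trans : h b.+1 * h c.+1 * h c < h b * h c.+1 * h c.+1.
  by rewrite mulrAC ltr_pM2r ?h_gt0 ?IHc.
by apply; rewrite -!mulrA ltr_pM2l ?h_gt0 // (mulrC _ (h c)) h_logconvex; lia.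
Qed.

(** Both [h (b + e) / h b] and [h (c + e) / h c] telescope into [e] ratios, which [h_ratio_lt]
    compares one by one. *)
Lemma h_convex b c e : (0 < b < c)%N -> (0 < e)%N ->
  h c * h (b + e) < h b * h (c + e).
Proof.
move=> bc; case: e => // e _; elim: e => [|e IHe].
  by rewrite !addn1 mulrC h_ratio_lt.
have hb : 0 < h (b + e.+1) by apply: h_gt0; lia.
have hc : 0 < h (c + e.+1) by apply: h_gt0; lia.
rewrite -(ltr_pM2r hb) !(addnS _ e.+1).
have r : h (b + e.+1).+1 * h (c + e.+1) < h (b + e.+1) * h (c + e.+1).+1.
  by apply: h_ratio_lt; lia.
have hc0 : 0 < h c by apply: h_gt0; lia.
have hd : 0 < h (b + e.+1).+1 by apply: h_gt0; lia.
have hb0 : 0 < h b by apply: h_gt0; lia.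
rewrite mulrAC; apply: (@lt_trans _ _ (h b * h (c + e.+1) * h (b + e.+1).+1)).
  by rewrite ltr_pM2r.
by rewrite -!mulrA ltr_pM2l // mulrC [X in _ < X]mulrC.
Qed.

(** The value [c] absorbs the excesses [e u] one at a time. It only grows, so [b u < c] survives
    every transfer, and a nonzero transfer is strict by [h_convex]. The alternative [e u = 0] covers
    entries with nothing to transfer. *)
Lemma smoothing (I : eqType) (r : seq I) (b e : I -> nat) c :
  (0 < c)%N -> (forall u, u \in r -> (0 < b u)%N /\ ((b u < c)%N \/ e u = 0%N)) ->
  h c * \prod_(u <- r) h (b u + e u)
    <= \prod_(u <- r) h (b u) * h (c + \sum_(u <- r) e u)
    ?= iff all (fun u => e u == 0)%N r.
Proof.
elim: r c => [|x r IHr] c c_gt0 hr.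
  by rewrite !big_nil mulr1 mul1r addn0; exact/leif_refl.
have [bx_gt0 bx] := hr x (mem_head x r).
have hr' c' u : (c <= c')%N -> u \in r ->
    (0 < b u)%N /\ ((b u < c')%N \/ e u = 0%N).
  move=> cc ur; have [|b0 [bc|e0]] := hr u; first by rewrite inE ur orbT.
    by split=> //; left; apply: leq_trans cc.
  by split=> //; right.
rewrite !big_cons /=; have [ex0|ex_neq0] := eqVneq (e x) 0%N.
  rewrite ex0 addn0 add0n mulrCA -mulrA /=.
  have := IHr c c_gt0 (fun u => hr' c u (leqnn c)).
  by rewrite -(mono_leif (ler_pM2l (h_gt0 bx_gt0))).
have ex_gt0 : (0 < e x)%N by rewrite lt0n.
have [bxc|/eqP] := bx; last by rewrite (negPf ex_neq0).
apply/leifP => /=; rewrite mulrA addnA.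
have P0 : 0 < \prod_(u <- r) h (b u + e u).
  rewrite big_seq; apply: prodr_gt0 => u ur; apply: h_gt0.
  by have [b0 _] := hr' c u (leqnn c) ur; rewrite addn_gt0 b0.
have IH := IHr (c + e x)%N (ltn_addr _ c_gt0) (fun u => hr' _ u (leq_addr _ _)).
(* Moving [e x] onto [c] is already strict; the induction hypothesis at [c + e x] moves the rest. *)
apply: (@lt_le_trans _ _ (h (b x) * h (c + e x) * \prod_(u <- r) h (b u + e u))).
  by rewrite ltr_pM2r //; apply: h_convex; rewrite // bx_gt0.
rewrite -!mulrA ler_pM2l; last exact: h_gt0.
exact: IH.1.
Qed.

(** Smoothing from base degrees 2 on [S] and 1 elsewhere: [a] keeps [d a] and absorbs what all other
    vertices have above their base. *)
Lemma prod_deg_le (I : finType) (d : I -> nat) (S : {set I}) (a : I) :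
  a \in S -> (forall u, ((u \in S) < d u)%N) ->
  (forall u, u != a -> ((u \in S).+1 < d a)%N \/ d u = (u \in S).+1) ->
  (\sum_u d u)%N = (#|I|.-1).*2 ->
  \prod_u h (d u) <= h 2 ^+ #|S|.-1 * h (#|I| - #|S|)
    ?= iff [forall u, (u != a) ==> (d u == (u \in S).+1)].
Proof.
move=> aS dS da sd.
pose b u := (u \in S).+1; pose e u := (d u - b u)%N.
have be u : (b u + e u)%N = d u by exact: subnKC (dS u).
pose r := [seq u <- index_enum I | u != a].
have Sgt0 : (0 < #|S|)%N by apply/card_gt0P; exists a.
have prodb : \prod_(u <- r) h (b u) = h 2 ^+ #|S|.-1.
  rewrite big_filter (bigID (mem S)) /= [X in _ * X]big1 ?mulr1; last first.
    by move=> u /andP[_ /negPf uS]; rewrite /b uS.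
  rewrite (eq_bigl (mem (S :\ a))); last by move=> u; rewrite !inE.
  rewrite (eq_bigr (fun=> h 2)); last by move=> u; rewrite !inE /b => /andP[_ ->].
  by rewrite prodr_const (cardsD1 a S) aS.
(* With N = [#|I|], the degree sum 2(N - 1) minus the bases (N - 1) + ([#|S|] - 1) of the vertices
   other than [a] leaves N - [#|S|]. *)
have sume : (d a + \sum_(u <- r) e u = #|I| - #|S|)%N.
  have := sd; rewrite (bigD1 a) //= -big_filter -/r.
  have -> : (\sum_(u <- r) d u = \sum_(u <- r) b u + \sum_(u <- r) e u)%N.
    by rewrite -big_split; apply: eq_bigr => u _ /=; rewrite be.
  have -> : (\sum_(u <- r) b u = #|I|.-1 + #|S|.-1)%N.
    rewrite /b big_filter.
    under eq_bigr do rewrite -addn1.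
    rewrite big_split /= addnC sum1_card cardC1; congr (_ + _)%N.
    rewrite -big_mkcondr /= sum1_card (cardsD1 a S) aS /=.
    by apply: eq_card => u; rewrite !inE.
  have : (0 < #|I|)%N by apply/card_gt0P; exists a.
  move: (\sum_(u <- r) e u)%N #|I| #|S| Sgt0 => s i j; lia.
have -> : \prod_u h (d u) = h (d a) * \prod_(u <- r) h (b u + e u).
  by rewrite (bigD1 a) //= -big_filter; under [in RHS]eq_bigr do rewrite be.
have := smoothing (r := r) (b := b) (e := e) (c := d a).
rewrite prodb sume => sm.
have -> : [forall u, (u != a) ==> (d u == (u \in S).+1)] = all (fun u => e u == 0)%N r.
  apply/forallP/allP => [H u|H u].
    by rewrite mem_filter => /andP[ua _]; have := H u; rewrite ua /e subn_eq0 /= => /eqP->.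
  apply/implyP => ua; have := H u; rewrite mem_filter ua mem_index_enum => /(_ isT).
  by move=> /eqP e0; rewrite -(be u) e0 addn0.
apply: sm => [|u]; first by apply: leq_ltn_trans (dS a).
rewrite mem_filter => /andP[ua _]; split=> //.
case: (da u ua) => [|du]; first by left.
by right; rewrite /e du subnn.
Qed.

End Smoothing.

(** * Log-convexity of [x ^ x] *)

(** Bernoulli's inequality for [(1 - 1 / (M + 1)) ^ (x + 1)], cleared of denominators and
    subtractions. *)
Lemma expn_bernoulli M x : M.+1 ^ x.+1 <= M ^ x.+1 + x.+1 * M.+1 ^ x.
Proof.
elim: x => [|x IHx]; first by rewrite !expn1 expn0; lia.
have := leq_mul (leqnn M.+1) IHx.
have : M ^ x.+1 <= M.+1 ^ x.+1 by rewrite leq_exp2r.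
rewrite !(expnS _ x.+1) (expnS M.+1 x).
move: (M ^ x.+1) (M.+1 ^ x) => p q; nia.
Qed.

(* With [N = (x + 1) ^ 2] this reads [N ^ (x + 1) < (N - 1) ^ x * (x + 2) ^ 2],
   and Bernoulli bounds [(N - 1) ^ x] below by [(N - x) * N ^ (x - 1)]. *)
Lemma selfexp_logconvex x : 0 < x ->
  x.+1 ^ x.+1 * x.+1 ^ x.+1 < x ^ x * x.+2 ^ x.+2.
Proof.
case: x => // x _; have := expn_bernoulli (x.+1 * x.+3) x.
have -> : (x.+1 * x.+3).+1 = x.+2 * x.+2 by lia.
rewrite -expnMn (expnS _ x.+1) (expnS _ x).
have -> : x.+1 ^ x.+1 * x.+3 ^ x.+3 = (x.+1 * x.+3) ^ x.+1 * (x.+3 * x.+3).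
  by rewrite expnMn (expnS x.+3 x.+2) (expnS x.+3 x.+1); ring.
have : 0 < (x.+2 * x.+2) ^ x by rewrite expn_gt0.
move: ((x.+2 * x.+2) ^ x) ((x.+1 * x.+3) ^ x.+1) => q p q0 B.
have : (x.+2 * x.+2 - x.+1) * q * (x.+3 * x.+3) <= p * (x.+3 * x.+3).
  by rewrite leq_mul2r mulnBl; apply/orP; right; lia.
move=> /(leq_trans _); apply.
have K : x.+2 * x.+2 * (x.+2 * x.+2) < (x.+2 * x.+2 - x.+1) * (x.+3 * x.+3).
  have -> : x.+2 * x.+2 - x.+1 = x * x + 3 * x + 3 by lia.
  by nia.
by rewrite [X in _ < X]mulnAC mulnA ltn_pmul2r.
Qed.

(** * Degree products under a fixed degree sum *)

Section Extremal.
Import Order.TTheory GRing.Theory Num.Theory.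
Variables (I : finType) (d : I -> nat) (S : {set I}) (a : I).
Hypotheses (aS : a \in S) (dS : forall u, (u \in S) < d u).
Hypothesis da : forall u, u != a -> (u \in S).+1 < d a \/ d u = (u \in S).+1.
Hypothesis sum_d : \sum_u d u = (#|I|.-1).*2.

Let extremal := [forall u, (u != a) ==> (d u == (u \in S).+1)].

Lemma prod_selfexp_deg_leqif :
  \prod_u d u ^ d u <= 4 ^ #|S|.-1 * (#|I| - #|S|) ^ (#|I| - #|S|) ?= iff extremal.
Proof.
have := @prod_deg_le rat (fun x => (x ^ x)%:R%R) _ _ _ I d S a aS dS da sum_d.
rewrite -natr_prod -natrX -natrM => L.
have {L} := L _ _ _; case=> [x x0||x x0|].
- by rewrite ltr0n expn_gt0 x0.
- by [].
- by rewrite -!natrM ltr_nat selfexp_logconvex.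
by rewrite ler_nat eqr_nat => le eq; split.
Qed.

(** The weight [1 / x] turns the upper bound into a lower one; its log-convexity amounts to x(x + 2)
    < (x + 1)^2. *)
Lemma prod_deg_leqif :
  2 ^ #|S|.-1 * (#|I| - #|S|) <= \prod_u d u ?= iff extremal.
Proof.
have := @prod_deg_le rat (fun x => x%:R^-1%R) _ _ _ I d S a aS dS da sum_d.
rewrite prodfV -natr_prod exprVn -invfM -natrX -natrM => L.
have {L} := L _ _ _; case=> [x x0||x x0|].
- by rewrite invr_gt0 ltr0n.
- by rewrite invr1.
- by rewrite -!invfM -!natrM ltf_pV2 ?posrE ?ltr0n ?muln_gt0 ?x0 // ltr_nat; nia.
have P0 : 0 < \prod_u d u by apply: prodn_gt0 => u; apply: leq_ltn_trans (dS u).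
(* Summing the base degrees gives [#|I| + #|S| <= 2 * (#|I| - 1)], so the truncated subtraction is
   positive and both sides can be inverted. *)
have SI : 0 < 2 ^ #|S|.-1 * (#|I| - #|S|).
  rewrite muln_gt0 expn_gt0 /= subn_gt0.
  have : \sum_u (u \in S).+1 <= \sum_u d u by apply: leq_sum => u _; apply: dS.
  have : 0 < #|I| by apply/card_gt0P; exists a.
  rewrite sum_d; under eq_bigr do rewrite -addn1.
  by rewrite big_split /= sum1_card -big_mkcond sum1_card; move: #|I| #|S| => i j; lia.
rewrite lef_pV2 ?posrE ?ltr0n // ler_nat.
rewrite (inj_eq invr_inj) eqr_nat eq_sym => le eq; split=> //.
Qed.

End Extremal.

(** * Double counting of edges *)

Section Edges.
Variables (n : nat) (T : rel 'I_n).
Hypotheses (symT : symmetric T) (irrT : irreflexive T).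

(** Each edge is seen once from each end: swapping matches the pairs with u > w to those with u < w,
    and irreflexivity empties the diagonal. Addition gives the handshake lemma, multiplication the
    vertex form of [Pi2]. *)
Lemma big_edges (R : Type) (idx : R) (op : Monoid.com_law idx) (F : 'I_n -> R) :
  \big[op/idx]_(p in edges T) op (F p.1) (F p.2) =
  \big[op/idx]_u \big[op/idx]_(w | T u w) F u.
Proof.
rewrite pair_big_dep /= [RHS](bigID (fun p : 'I_n * 'I_n => p.1 < p.2)) /= big_split /=.
congr (_ _ _); first by apply: eq_bigl => p; rewrite inE andbC.
pose swap (p : 'I_n * 'I_n) := (p.2, p.1).
have swapK : involutive swap by case.
rewrite [RHS](reindex_inj (inv_inj swapK)) /=.
apply: eq_bigl => -[u w]; rewrite inE /= symT andbC -leqNgt [in RHS]leq_eqVlt.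
by have [/val_inj ->|//] := eqVneq (u : nat) w; rewrite irrT.
Qed.

Lemma sum_deg : \sum_u deg T u = (#|edges T|).*2.
Proof.
have := big_edges addn (fun=> 1).
rewrite sum_nat_const => E; rewrite -muln2 E.
by apply: eq_bigr => u _; rewrite sum1dep_card /deg cardsE.
Qed.

Lemma Pi2_deg : Pi2 T = \prod_u deg T u ^ deg T u.
Proof.
rewrite /Pi2 (big_edges muln (deg T)); apply: eq_bigr => u _.
by rewrite prod_nat_const -cardsE.
Qed.

End Edges.

(** * Distances and parents in a tree *)

Section Distance.
Variables (n : nat) (T : rel 'I_n).
Hypotheses (symT : symmetric T) (irrT : irreflexive T).
Hypothesis connT : forall u v, connect T u v.
Implicit Types u v w r : 'I_n.

(** Balls as finite sets make bounded distance decidable, so [dist] can be defined as a least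
    radius. *)
Fixpoint ball r m : {set 'I_n} :=
  if m is m'.+1 then ball r m' :|: [set w | [exists v in ball r m', T v w]]
  else [set r].

Lemma ball_mono r m m' : m <= m' -> ball r m \subset ball r m'.
Proof.
move=> /subnK <-; elim: (m' - m) => [|j IHj]; first exact: subxx.
exact: subset_trans IHj (subsetUl _ _).
Qed.

Lemma ball_step r m v w : v \in ball r m -> T v w -> w \in ball r m.+1.
Proof.
by move=> vB vw; rewrite !inE; apply/orP; right; apply/existsP; exists v; rewrite vB.
Qed.

Lemma ball_exists r v : exists m, v \in ball r m.
Proof.
have /connectP[p + ->] := connT r v.
elim/last_ind: p => [|p x IHp]; first by exists 0; rewrite inE.
rewrite rcons_path last_rcons => /andP[/IHp[m xB] px].
by exists m.+1; apply: ball_step px.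
Qed.

Definition dist r v := ex_minn (ball_exists r v).

Lemma dist_leE r v m : (dist r v <= m) = (v \in ball r m).
Proof.
rewrite /dist; case: ex_minnP => d vB dmin; apply/idP/idP; last exact: dmin.
by move=> /(ball_mono r)/subsetP; apply.
Qed.

Lemma dist_eq0 r v : (dist r v == 0) = (v == r).
Proof. by rewrite -leqn0 dist_leE inE. Qed.

Lemma dist_step r v w : T v w -> dist r w <= (dist r v).+1.
Proof. by rewrite dist_leE; apply: ball_step; rewrite -dist_leE. Qed.

Lemma dist_pred r v m : dist r v = m.+1 -> exists2 w, T w v & dist r w = m.
Proof.
move=> dv; have: v \in ball r m.+1 by rewrite -dist_leE dv.
rewrite /= inE -dist_leE dv ltnn inE /= => /existsP[w /andP[]].
rewrite -dist_leE => dw wv; exists w => //.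
by have := dist_step r wv; lia.
Qed.

Lemma dist_le_of_dist r v m : dist r v <= m -> dist_le T m v r.
Proof.
rewrite dist_leE; elim: m v => [|m IHm] v.
  by rewrite inE => /eqP ->; exists [::].
rewrite /= inE => /orP[/IHm[p [pT pl ps]]|]; first by exists p; split; rewrite // leqW.
rewrite inE => /existsP[w /andP[/IHm[p [pT pl ps]] wv]].
by exists (w :: p); split; rewrite //= symT wv.
Qed.

(** Built backwards from [v] through nearer neighbours. Recording the level of each [g i] makes the
    path injective at no further cost. *)
Lemma dist_geodesic r v m : dist r v = m ->
  exists g : nat -> 'I_n, [/\ g m = v, forall i, i <= m -> dist r (g i) = i
    & forall i, i < m -> T (g i) (g i.+1)].
Proof.
elim: m v => [|m IHm] v dv.
  by exists (fun=> v); split=> // i; rewrite leqn0 => /eqP->.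
have [w wv dw] := dist_pred dv.
have [g [gm gd gT]] := IHm w dw.
exists (fun i => if i == m.+1 then v else g i); split=> [|i im|i im].
- by rewrite eqxx.
- by case: eqP => [->//|/eqP im']; apply: gd; lia.
- rewrite ltn_eqF // eqSS; case: eqP => [->|/eqP im']; first by rewrite gm.
  by apply: gT; lia.
Qed.

Hypothesis cardT : #|edges T| = n.-1.

(** In a connected graph the default [v] is reached only at the root [r]. *)
Definition parent r v :=
  odflt v [pick w | T w v && (dist r v == (dist r w).+1)].

Lemma parentP r v : v != r -> T (parent r v) v /\ dist r v = (dist r (parent r v)).+1.
Proof.
rewrite -dist_eq0 => dv0; rewrite /parent; case: pickP => [w /andP[wv /eqP dw] //|no].
case dv: (dist r v) dv0 => [//|m] _.
by have [w wv dw] := dist_pred dv; have := no w; rewrite wv dv dw eqxx.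
Qed.

(* The n - 1 oriented pairs (parent v, v) and their n - 1 reversals already
   exhaust the 2 (n - 1) oriented edges. *)
Lemma edge_parent r v w : T v w ->
  (w != r /\ v = parent r w) \/ (v != r /\ w = parent r v).
Proof.
pose down := [set (parent r x, x) | x in [set~ r]].
pose up := [set (x, parent r x) | x in [set~ r]].
pose E := [set p : 'I_n * 'I_n | T p.1 p.2].
have cE : #|E| = (n.-1).*2.
  rewrite -cardT -(sum_deg symT irrT) -sum1dep_card.
  rewrite -(pair_big_dep predT (fun u w => T u w) (fun _ _ => 1)) /=.
  by apply: eq_bigr => u _; rewrite sum1dep_card /deg cardsE.
have cd : #|down| = n.-1.
  by rewrite card_imset; [rewrite cardsC1 card_ord | move=> x y [_]].
have cu : #|up| = n.-1.
  by rewrite card_imset; [rewrite cardsC1 card_ord | move=> x y []].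
have dis : [disjoint down & up].
  apply/pred0P => p /=; apply/negP => /andP[/imsetP[x]].
  rewrite !inE => xr -> /imsetP[y]; rewrite !inE => yr [ey ex].
  have [_] := parentP xr; have [_] := parentP yr.
  by rewrite -ex ey; lia.
have sub : down :|: up \subset E.
  apply/subsetP => p; rewrite inE => /orP[] /imsetP[x]; rewrite !inE => xr -> /=.
    by case: (parentP xr).
  by rewrite symT; case: (parentP xr).
have EE : down :|: up = E.
  apply/eqP; rewrite eqEcard sub cE cardsU cd cu.
  by rewrite (disjoint_setI0 dis) cards0 subn0 addnn /= leqnn.
move=> vw; have: (v, w) \in E by rewrite inE.
rewrite -EE inE => /orP[] /imsetP[x]; rewrite !inE => xr [ev ew].
  by left; rewrite ew.
by right; rewrite ev.
Qed.

(** Every edge is a parent edge, so none joins two vertices of the same level. *)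
Lemma dist_edge r v w : T v w ->
  dist r w = (dist r v).+1 \/ dist r v = (dist r w).+1.
Proof.
by move=> /(edge_parent r)[[/parentP[_ dw] ->]|[/parentP[_ dv] ->]]; [left|right].
Qed.

Lemma parent_uniq r v w : T v w -> dist r v = (dist r w).+1 -> w = parent r v.
Proof.
move=> /(edge_parent r)[[wr ->]|[] //].
by have [_] := parentP wr; lia.
Qed.

(** The edge from [x] to [c] has [w] on the side of [x] and [y] on the side of [c]. Walking from [c]
    to [y], each step moves away from [w]. *)
Lemma dist_add w y x c : T x c -> dist w c = (dist w x).+1 ->
  dist y x = (dist y c).+1 -> dist w y = dist w c + dist y c.
Proof.
move dm: (dist y c) => m.
elim: m x c dm => [|m IHm] x c dm xc dc dx.
  by move/eqP: dm; rewrite dist_eq0 addn0 => /eqP->.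
have [z zc dz] := dist_pred dm.
have cz : T c z by rewrite symT.
have dwz : dist w z = (dist w c).+1.
  have [//|dcz] := dist_edge w cz.
  (* The only neighbour of [c] nearer to [w] is [x], which is farther from [y] than [c], whereas [z]
     is nearer. *)
  have zx : z = x.
    by rewrite (parent_uniq cz dcz) (parent_uniq (w := x) _ dc) // symT.
  by rewrite zx dx in dz; lia.
by rewrite (IHm c z dz cz dwz) ?dm // dwz addSnnS.
Qed.

(* If [c] has minimal eccentricity, a farthest vertex [w] from [c] and a
   farthest vertex [y] from the neighbour of [c] towards [w] lie on opposite
   sides of [c]. *)
Lemma long_dist k (c0 : 'I_n) : (forall c, exists r, k < dist r c) ->
  exists w y, k.*2 < dist w y.
Proof.
move=> far.
pose ecc c := \max_r dist r c.
have ecc_far c : exists r, dist r c = ecc c.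
  have n_gt0 : 0 < #|'I_n| by apply/card_gt0P; exists c.
  by have [r e] := eq_bigmax (fun r => dist r c) n_gt0; exists r.
have [c _ cmin] := arg_minnP ecc (isT : xpredT c0).
have kc : k < ecc c.
  by have [r kr] := far c; apply: leq_trans kr (leq_bigmax (F := fun r => dist r c) r).
have [w dw] := ecc_far c.
have [x xc dx] : exists2 x, T x c & dist w x = (ecc c).-1.
  by apply: dist_pred; lia.
have [y dy] := ecc_far x.
have yc : dist y c <= ecc c by apply: (leq_bigmax (F := fun r => dist r c)).
have cx := cmin x isT.
(* Otherwise [dist y c] would be [ecc x + 1], exceeding [ecc c]. *)
have dyx : dist y x = (dist y c).+1.
  by case: (dist_edge y xc) => //; lia.
(* Here [dist w c = ecc c > k], and [dist y c = ecc x - 1 >= ecc c - 1 >= k]. *)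
exists w, y; rewrite (dist_add xc _ dyx); lia.
Qed.

End Distance.

(** * Neighbourhoods of vertices of small degree *)

Section Degree.
Variables (n : nat) (e : rel 'I_n) (u : 'I_n).

Lemma deg1_adj x w : deg e u = 1 -> e u x -> e u w = (w == x).
Proof.
rewrite /deg => /eqP/cards1P[y E] ux.
have := in_set1 w y; have := in_set1 x y; rewrite -E !inE ux => /esym/eqP->.
by [].
Qed.

Lemma deg2_adj x y w : deg e u = 2 -> e u x -> e u y -> x != y ->
  e u w = (w == x) || (w == y).
Proof.
move=> du ux uy xy; have E : [set x; y] = [set w | e u w].
  apply/eqP; rewrite eqEcard cards2 xy -/(deg e u) du andbT.
  by apply/subsetP => z; rewrite !inE => /orP[]/eqP->.
by have := in_set2 w x y; rewrite E inE.
Qed.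

Lemma deg_eq1 x : (forall w, e u w = (w == x)) -> deg e u = 1.
Proof. by move=> ex; rewrite -(cards1 x); apply: eq_card => w; rewrite !inE. Qed.

Lemma deg_eq2 x y : x != y -> (forall w, e u w = (w == x) || (w == y)) -> deg e u = 2.
Proof.
move=> xy exy; have <- : #|[set x; y]| = 2 by rewrite cards2 xy.
by apply: eq_card => w; rewrite !inE.
Qed.

Lemma deg_gt0 x : e u x -> 0 < deg e u.
Proof. by move=> ux; apply/card_gt0P; exists x; rewrite inE. Qed.

Lemma deg_gt1 x y : e u x -> e u y -> x != y -> 1 < deg e u.
Proof. by move=> ux uy xy; apply/card_gt1P; exists x, y; rewrite !inE. Qed.

End Degree.

(** * A path on 2k + 2 vertices and rigidity of the extremal degrees *)

Section Spine.
Variables (n : nat) (T : rel 'I_n) (k : nat) (v : nat -> 'I_n).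
Hypotheses (symT : symmetric T) (irrT : irreflexive T).
Hypothesis connT : forall u v, connect T u v.
Hypothesis v_inj : forall i j, i <= k.*2.+1 -> j <= k.*2.+1 -> v i = v j -> i = j.
Hypothesis v_adj : forall i, i <= k.*2 -> T (v i) (v i.+1).

Definition spine := [set v i.+1 | i : 'I_k.*2].

Lemma mem_spine i : i <= k.*2.+1 -> (v i \in spine) = (0 < i <= k.*2).
Proof.
move=> ik; apply/imsetP/idP => [[j _ vij]|].
  have jk := ltn_ord j; have jk' : j.+1 <= k.*2.+1 by rewrite ltnS ltnW.
  by rewrite (v_inj ik jk' vij).
by case: i ik => // i _ ik; exists (Ordinal (ik : i < k.*2)).
Qed.

Lemma card_spine : #|spine| = k.*2.
Proof.
rewrite card_imset ?card_ord // => i j vij.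
have le_ord (x : 'I_k.*2) : x.+1 <= k.*2.+1 by rewrite ltnS ltnW.
by have [] := v_inj (le_ord i) (le_ord j) vij => /val_inj.
Qed.

Lemma spine_deg u : (u \in spine) < deg T u.
Proof.
case: (boolP (u \in spine)) => [/imsetP[i _ ->]|_].
  apply: (@deg_gt1 _ _ _ (v i) (v i.+2)); have i2 := ltn_ord i.
  - by rewrite symT v_adj // ltnW.
  - by rewrite v_adj.
  - by apply/eqP => /v_inj; lia.
have [->|uv] := eqVneq u (v 0); first by apply: deg_gt0 (v_adj (leq0n _)).
have [pu _] := parentP connT uv.
by apply: (@deg_gt0 _ _ _ (parent connT (v 0) u)); rewrite symT.
Qed.

Lemma uniq_mkseq_v : uniq (mkseq v k.*2.+2).
Proof. by apply/mkseq_uniqP => i j; rewrite !inE !ltnS => ik jk; apply: v_inj. Qed.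

Lemma spine_size : k.*2.+2 <= n.
Proof.
have /card_uniqP := uniq_mkseq_v; rewrite size_mkseq => <-.
by rewrite -[X in _ <= X]card_ord; apply: max_card.
Qed.

(** List the path first and the other vertices after it; the label is the position in this list. The
    order off the path is immaterial, since those vertices will be leaves with a common
    neighbour. *)
Lemma spine_labelling : exists2 f : 'I_n -> 'I_n, injective f
  & forall i, i <= k.*2.+1 -> f (v i) = i :> nat.
Proof.
pose P := mkseq v k.*2.+2; pose L := P ++ [seq u <- enum 'I_n | u \notin P].
have uniqL : uniq L.
  rewrite cat_uniq uniq_mkseq_v filter_uniq ?enum_uniq // andbT /=.
  by apply/hasPn => u; rewrite mem_filter => /andP[].
have memL u : u \in L by rewrite mem_cat mem_filter mem_enum andbT orbN.
have sizeL : size L = n.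
  by rewrite -(card_uniqP uniqL) (eq_card (B := 'I_n)) ?card_ord // => u; rewrite memL.
have ltL u : index u L < n by rewrite -[X in _ < X]sizeL index_mem.
exists (fun u => Ordinal (ltL u)) => [u w /(congr1 val) uw|i ik].
  by apply: index_inj uw.
change (index (v i) L = i).
have vi : v i = nth (v 0) P i by rewrite nth_mkseq.
have iP : i < size P by rewrite size_mkseq.
by rewrite vi index_cat mem_nth // index_uniq // uniq_mkseq_v.
Qed.

Hypothesis cardT : #|edges T| = n.-1.

(** The degrees fix every adjacency row except that of [v a]: path neighbours exhaust the rows on
    the path, and a vertex off the path is a leaf that can only hang on [v a]. *)
Lemma spine_isomorphic a : 0 < a <= k.*2 ->
  (forall u, u != v a -> deg T u = (u \in spine).+1) -> isomorphic T (@Tak n k a).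
Proof.
move=> ak degT; have [f f_inj f_v] := spine_labelling.
exists f; split; first exact: injF_bij.
have v_f u : f u <= k.*2.+1 -> u = v (f u).
  by move=> uk; apply/f_inj/val_inj; rewrite /= f_v.
have eq_v u i : i <= k.*2.+1 -> (u == v i) = (f u == i :> nat).
  by move=> ik; rewrite -(inj_eq f_inj) -val_eqE /= f_v.
have spine_f u : (u \in spine) = (0 < f u <= k.*2).
  have [uk|uk] := leqP (f u) k.*2.+1; first by rewrite {1}(v_f u uk) mem_spine.
  transitivity false; last by lia.
  apply/imsetP => -[i _ ui]; have := ltn_ord i.
  by have := f_v i.+1; rewrite -ui; lia.
have row_spine u w : u != v a -> f u <= k.*2.+1 -> T u w = Tak k a (f u) (f w).
  move=> ua uk; have := degT u ua; rewrite spine_f => du.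
  have fua : f u != a :> nat by rewrite -eq_v //; lia.
  have uv : u = v (f u) := v_f u uk.
  rewrite /Tak.
  case fu: (f u : nat) => [|i] in du fua uk uv *.
    have uv1 : T u (v 1) by rewrite uv v_adj.
    rewrite (deg1_adj w du uv1) eq_v //.
    move: (f w : nat) => j; clear -ak; lia.
  have ui : T u (v i) by rewrite uv symT v_adj.
  have [ik|ik] := leqP i.+1 k.*2; last first.
    rewrite (deg1_adj w _ ui); last by rewrite du; lia.
    rewrite eq_v; last by lia.
    move: (f w : nat) => j; clear -ak ik uk fua; lia.
  have uii : T u (v i.+2) by rewrite uv v_adj.
  rewrite (deg2_adj w _ ui uii); [|by rewrite du; lia|by apply/eqP => /v_inj; lia].
  rewrite !eq_v; [|by lia|by lia].
  move: (f w : nat) => j; clear -ak ik uk fua; lia.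
have row u w : u != v a -> T u w = Tak k a (f u) (f w).
  move=> ua; have [uk|uk] := leqP (f u) k.*2.+1; first exact: row_spine.
  have deg1 x : k.*2.+1 < f x -> deg T x = 1.
    move=> xk; rewrite degT ?spine_f; first by lia.
    by rewrite eq_v; lia.
  have off_root x : k.*2.+1 < f x -> x != v 0 by move=> xk; rewrite eq_v; lia.
  have [xu du] := parentP connT (off_root u uk).
  set x := parent connT (v 0) u in xu du.
  have ux : T u x by rewrite symT.
  have xa : x = v a.
    (* If [x] were another path vertex, its known row would exclude [u]. If it were off the path,
       [x] and [u] would be leaves and each the parent of the other. *)
    apply/eqP; apply/negPn/negP => xa.
    have [xk|xk] := leqP (f x) k.*2.+1.
      have := row_spine x u xa xk; rewrite xu /Tak => /esym.
      by rewrite eq_v in xa; lia.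
    have [yx dx] := parentP connT (off_root x xk).
    have := deg1_adj (parent connT (v 0) x) (deg1 x xk) xu.
    by rewrite symT yx => /esym/eqP yu; rewrite yu in dx; lia.
  rewrite (deg1_adj w (deg1 u uk) ux) xa eq_v; last by lia.
  have := eq_v u a; rewrite (negPf ua) /Tak.
  move: (f w : nat) (ltn_ord (f w)) => j; clear -ak uk; lia.
move=> u w; have [ua|/row//] := eqVneq u (v a).
(* The row of [v a] follows from the other rows by symmetry, and its diagonal entry from
   irreflexivity. *)
have [wa|wa] := eqVneq w (v a).
  rewrite ua wa irrT /Tak f_v; [clear -ak|]; lia.
rewrite symT (row w u wa) /Tak.
move: (f w : nat) (f u : nat) => i j; lia.
Qed.

End Spine.

(** * Bounds for [Pi1] and [Pi2] with their equality case *)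

Section Values.
Variables (n : nat) (T : rel 'I_n) (S : {set 'I_n}) (a : 'I_n).
Hypotheses (symT : symmetric T) (irrT : irreflexive T).
Hypothesis cardT : #|edges T| = n.-1.
Hypotheses (aS : a \in S) (degS : forall u, (u \in S) < deg T u).
Hypothesis dega : forall u, u != a -> (u \in S).+1 < deg T a \/ deg T u = (u \in S).+1.

Let extremal := [forall u, (u != a) ==> (deg T u == (u \in S).+1)].

Let sum_degT : \sum_u deg T u = (#|'I_n|.-1).*2.
Proof. by rewrite (sum_deg symT irrT) cardT card_ord. Qed.

Lemma Pi1_leqif : 4 ^ #|S|.-1 * (n - #|S|) ^ 2 <= Pi1 T ?= iff extremal.
Proof.
have := prod_deg_leqif aS degS dega sum_degT; rewrite card_ord.
rewrite -(mono_leqif (f := fun x => x ^ 2)); last by move=> x y; rewrite leq_exp2r.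
by rewrite (big_morph _ (fun x y => expnMn x y 2) (exp1n 2)) expnMn -expnM (mulnC _ 2) expnM.
Qed.

Lemma Pi2_leqif : Pi2 T <= 4 ^ #|S|.-1 * (n - #|S|) ^ (n - #|S|) ?= iff extremal.
Proof.
rewrite (Pi2_deg symT irrT).
by have := prod_selfexp_deg_leqif aS degS dega sum_degT; rewrite card_ord.
Qed.

End Values.

(** * Degrees in the candidate extremal tree *)

Section StarPath.
Variables (n k a : nat).
Hypotheses (ak : 0 < a <= k) (kn : k.*2.+2 <= n).

Lemma Tak_deg (i : 'I_n) : i != a :> nat -> deg (@Tak n k a) i = (0 < i <= k.*2).+1.
Proof.
have an : a < n by lia.
move=> ia; have [ik|ik] := leqP k.*2.+2 i.
  rewrite (@deg_eq1 _ _ _ (Ordinal an)) => [|w]; first by clear -ik; lia.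
  by rewrite /Tak -val_eqE /=; move: (ltn_ord w); lia.
case i0 : (i : nat) => [|j] in ia ik *.
  have lt1 : 1 < n by lia.
  rewrite (@deg_eq1 _ _ _ (Ordinal lt1)) => [|w]; first by [].
  by rewrite /Tak -val_eqE /= i0; lia.
have jn : j < n by lia.
have [jk|jk] := leqP j.+1 k.*2.
  have j2n : j.+2 < n by lia.
  rewrite (@deg_eq2 _ _ _ (Ordinal jn) (Ordinal j2n)) => [||w].
  - by clear -jk; lia.
  - by rewrite -val_eqE /=; clear; lia.
  by rewrite /Tak -!val_eqE /= i0; clear -jk ia ik ak; lia.
rewrite (@deg_eq1 _ _ _ (Ordinal jn)) => [|w]; first by clear -jk; lia.
by rewrite /Tak -val_eqE /= i0; clear -jk ia ik ak; lia.
Qed.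

Lemma Tak_deg_gt (i : 'I_n) : (0 < i <= k.*2) < deg (@Tak n k a) i.
Proof.
have [ia|ia] := eqVneq (i : nat) a; last by rewrite Tak_deg.
have an : a.-1 < n by lia.
have an' : a.+1 < n by lia.
apply: (leq_trans (n := 2)); first by case: (_ && _).
apply: (@deg_gt1 _ _ _ (Ordinal an) (Ordinal an')); rewrite /Tak -?val_eqE /= ?ia;
  clear -ak; lia.
Qed.

End StarPath.

(** * Values attained by the extremal trees *)

Section Converse.
Variables (n k a : nat) (T : rel 'I_n).
Hypotheses (symT : symmetric T) (irrT : irreflexive T).
Hypothesis cardT : #|edges T| = n.-1.
Hypotheses (ak : 0 < a <= k) (kn : k.*2.+2 <= n).

(** Degrees are pulled back along the isomorphism, with [S] the preimage of the inner labels and [c]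
    that of [a]. The equality clauses of the two bounds then give the values without evaluating any
    product. *)
Lemma Pi_isomorphic : isomorphic T (@Tak n k a) ->
  Pi1 T = 4 ^ (k.*2.-1) * (n - k.*2) ^ 2 /\
  Pi2 T = 4 ^ (k.*2.-1) * (n - k.*2) ^ (n - k.*2).
Proof.
case=> f [[g fK gK] fT].
have degf u : deg T u = deg (@Tak n k a) (f u).
  rewrite /deg -(card_imset _ (can_inj fK)); apply: eq_card => w.
  rewrite inE; apply/imsetP/idP => [[x]|fw]; first by rewrite inE fT => ? ->.
  by exists (g w); rewrite ?gK // inE fT gK.
pose S := [set u | 0 < f u <= k.*2].
have an : a < n by lia.
pose c := g (Ordinal an); have fc : f c = a :> nat by rewrite /c gK.
have cS : c \in S by rewrite inE fc; clear -ak; lia.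
have degS u : (u \in S) < deg T u by rewrite degf inE Tak_deg_gt.
have degc u : u != c -> deg T u = (u \in S).+1.
  move=> uc; rewrite degf inE Tak_deg // -fc.
  by apply: contraNneq uc => /val_inj/(can_inj fK)->.
have cardS : #|S| = k.*2.
  have lt_n (i : 'I_k.*2) : i.+1 < n by have := ltn_ord i; lia.
  have inj : injective (fun i => g (Ordinal (lt_n i))).
    by move=> i j /(can_inj gK)/(congr1 val)/=[/val_inj].
  rewrite -[RHS]card_ord -(card_imset _ inj); apply: eq_card => u; rewrite inE.
  apply/idP/imsetP => [fu|[i _ ->]]; last by rewrite gK /=; have := ltn_ord i; lia.
  have uk : (f u).-1 < k.*2 by lia.
  exists (Ordinal uk) => //; rewrite -[LHS]fK; congr (g _); apply: val_inj => /=; lia.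
have ext : [forall u, (u != c) ==> (deg T u == (u \in S).+1)].
  by apply/forallP => u; apply/implyP => /degc->.
have degc' u : u != c -> (u \in S).+1 < deg T c \/ deg T u = (u \in S).+1.
  by move=> /degc; right.
have [_] := Pi1_leqif symT irrT cardT cS degS degc'.
have [_] := Pi2_leqif symT irrT cardT cS degS degc'.
by rewrite ext cardS => /eqP-> /eqP->.
Qed.

End Converse.

(** * From domination number two to the bounds and the extremal trees *)

Theorem theorem3p2 (n k : nat) (T : rel 'I_n) :
  2 <= k -> is_tree T -> gamma_k_eq T k 2 ->
  [/\ 4 ^ (k.*2.-1) * (n - k.*2) ^ 2 <= Pi1 T,
      Pi2 T <= 4 ^ (k.*2.-1) * (n - k.*2) ^ (n - k.*2),
      Pi1 T = 4 ^ (k.*2.-1) * (n - k.*2) ^ 2 <->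
        (exists2 a, 1 <= a <= k & isomorphic T (@Tak n k a)) &
      Pi2 T = 4 ^ (k.*2.-1) * (n - k.*2) ^ (n - k.*2) <->
        (exists2 a, 1 <= a <= k & isomorphic T (@Tak n k a))].
Proof.
move=> k2 [[symT irrT] [connT cardT]] [[D [_ cardD]] gmin].
have [c0 _] : exists c, c \in D by apply/card_gt0P; rewrite cardD.
(* If all vertices were within [k] of [c], the singleton of [c] would dominate, against the minimum
   2. *)
have far c : exists r, k < dist connT r c.
  apply/existsP; apply: contraT; rewrite negb_exists => /forallP near.
  suff /gmin : dist_k_dominating T k [set c] by rewrite cards1.
  move=> v _; exists c; first by rewrite inE.
  by apply: dist_le_of_dist => //; rewrite leqNgt.
have [w [y wy]] := long_dist symT irrT cardT c0 far.
have [v [_ v_dist v_adj']] := dist_geodesic (erefl (dist connT w y)).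
(* Path vertices lie at distinct distances from [w]; only the first 2k + 2 of the geodesic are
   used. *)
have v_inj i j : i <= k.*2.+1 -> j <= k.*2.+1 -> v i = v j -> i = j.
  move=> ik jk /(congr1 (dist connT w)).
  by rewrite !v_dist //; apply: leq_trans wy.
have v_adj i : i <= k.*2 -> T (v i) (v i.+1).
  by move=> ik; apply: v_adj'; apply: leq_ltn_trans ik wy.
pose S := spine k v; have cardS : #|S| = k.*2 := card_spine v_inj.
have nk := spine_size v_inj.
have degS u : (u \in S) < deg T u := spine_deg symT connT v_inj v_adj u.
have [b0 b0S] : exists b, b \in S by apply/card_gt0P; rewrite cardS; lia.
have [b b_in bmax] := arg_maxnP (deg T) b0S; have bS : b \in S := b_in.
(* Off [S] the base 1 is below [deg T b >= 2]. On [S], either [deg T b > 2] or, by maximality, all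
   degrees are exactly 2. *)
have degb u : u != b -> (u \in S).+1 < deg T b \/ deg T u = (u \in S).+1.
  move=> _; have := degS b; have := degS u; rewrite bS.
  have [uS du db|uS du db] := boolP (u \in S); last by left.
  have dub : deg T u <= deg T b := bmax u uS.
  by have [lt2|le2] := ltnP 2 (deg T b); [left|right; lia].
have := Pi1_leqif symT irrT cardT bS degS degb.
have := Pi2_leqif symT irrT cardT bS degS degb.
rewrite cardS; set E := [forall u, _] => P2 P1.
have E_iso : E -> exists2 a, 1 <= a <= k & isomorphic T (@Tak n k a).
  move=> /forallP extr.
  have {extr} deg_eq u : u != b -> deg T u = (u \in S).+1.
    by move=> ub; apply/eqP; have := extr u; rewrite ub.
  have [a0 _ ba] := imsetP bS; have a0k := ltn_ord a0.
  have [ak|ak] := leqP a0.+1 k.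
    exists a0.+1 => //; apply: (spine_isomorphic symT irrT connT v_inj v_adj cardT); first by lia.
    by rewrite -ba.
  (* The exceptional vertex lies in the second half; reversing the path sends its index [a0 + 1] to
     [2k + 1 - (a0 + 1)], which is at most [k]. *)
  exists (k.*2 - a0); first by lia.
  pose v' i := v (k.*2.+1 - i).
  have v'_inj i j : i <= k.*2.+1 -> j <= k.*2.+1 -> v' i = v' j -> i = j.
    by move=> ik jk /v_inj; lia.
  have v'_adj i : i <= k.*2 -> T (v' i) (v' i.+1).
    by move=> ik; rewrite symT /v' subSS subSn // v_adj // leq_subr.
  have S' : spine k v' = S.
    apply/eqP; rewrite eqEcard (card_spine v'_inj) cardS leqnn andbT.
    apply/subsetP => _ /imsetP[i _ ->]; have ik := ltn_ord i.
    by rewrite (mem_spine v_inj); lia.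
  apply: (spine_isomorphic symT irrT connT v'_inj v'_adj cardT); first by lia.
  move=> u; rewrite S' /v'.
  have -> : k.*2.+1 - (k.*2 - a0) = a0.+1 by lia.
  by rewrite -ba; apply: deg_eq.
split; [exact: P1.1|exact: P2.1|split=> [e|[a ak]]|split=> [e|[a ak]]].
- by apply: E_iso; rewrite -P1.2 e.
- by move=> /(Pi_isomorphic symT irrT cardT ak nk)[].
- by apply: E_iso; rewrite -P2.2 e.
- by move=> /(Pi_isomorphic symT irrT cardT ak nk)[].
Qed.
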